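(* Let $X=\mathbb R^d/\mathbb Z^d$ and let $T:X\to X$ be a hyperbolic toral endomorphism. Let $\mathcal M_T(X)$ be the space of $T$-invariant Borel probability measures on $X$ (with the weak-* topology). Then the set of measures $\mu\in\mathcal M_T(X)$ which give full measure to the set of Liouville points is comeager in $\mathcal M_T(X)$.
   Context: A toral endomorphism is a map $T([x])=[\mathbf Mx]$, where $\mathbf M$ is a $d\times d$ integer matrix and $[x]$ is the image of $x\in\mathbb R^d$ in $\mathbb R^d/\mathbb Z^d$; it is hyperbolic if all (complex) eigenvalues of $\mathbf M$ have modulus $\ne1$. The Liouville points are the points with infinite exponent of irrationality, that is, the points $[x]$ such that for every $n\in\mathbb N$ there exist $\mathbf p\in\mathbb Z^d$ and an integer $q\ge n$ with $\|x-\mathbf p/q\|<q^{-n}$ (the fraction $\mathbf p/q$ need not be reduced; in particular rational points count as Liouville points). This property does not depend on the representative $x$ of $[x]$. *)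

(* Defs.v *)
From HB Require Import structures.
From mathcomp Require Import all_boot all_order all_algebra.
From mathcomp Require Import generic_quotient ring_quotient complex.
From mathcomp Require Import all_classical all_reals all_analysis.

Set Implicit Arguments.
Unset Strict Implicit.
Unset Printing Implicit Defensive.

Import Order.TTheory GRing.Theory Num.Theory.
Import numFieldNormedType.Exports.

Local Open Scope classical_set_scope.
Local Open Scope ring_scope.
Local Open Scope quotient_scope.

(* Z^d as a subgroup of R^d (vectors are columns): `x \is a mxOver Num.int`,
   spelled with the predicate that carries the zmodClosed structure. *)
Definition int_lattice (R : realType) (d : nat) : zmodClosed 'cV[R]_d :=
  GRing.ZmodClosed.clone 'cV[R]_d (mxOver_pred (@Num.int_num_subdef R)) _.

Definition torus (R : realType) (d : nat) : ptopologicalType :=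
  quotient_topology (Quotient.quot (int_lattice R d)).

Definition torus_proj (R : realType) (d : nat) (x : 'cV[R]_d) : torus R d :=
  \pi_(quotient_topology (Quotient.quot (int_lattice R d))) x.

Lemma torus_projP (R : realType) (d : nat) (x y : 'cV[R]_d) :
  torus_proj x = torus_proj y <-> exists p : 'cV[int]_d, x - y = map_mx intr p.
Proof.
have -> : torus_proj x = torus_proj y <-> x - y \in int_lattice R d.
  rewrite (@Quotient.idealrBE _ (int_lattice R d)); split=> [xy|/eqP xy //].
  exact/eqP.
split=> [/mxOverP xy|[p ->]].
  exists (\col_i Num.floor ((x - y) i 0)); apply/matrixP => i j.
  by rewrite ord1 !mxE floorK//; have := xy i 0; rewrite !mxE.
by apply/mxOverP => i j; rewrite mxE intr_int.
Qed.

Lemma torus_proj_surj (R : realType) (d : nat) (t : torus R d) :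
  exists x : 'cV[R]_d, torus_proj x = t.
Proof.
exists (repr (t : quotient_topology (Quotient.quot (int_lattice R d)))).
exact: reprK.
Qed.

Definition toral_endomorphism (R : realType) (d : nat) (M : 'M[int]_d)
  (T : torus R d -> torus R d) : Prop :=
  forall x : 'cV[R]_d, T (torus_proj x) = torus_proj (map_mx intr M *m x).

Lemma toral_endomorphism_exists (R : realType) (d : nat) (M : 'M[int]_d) :
  exists T : torus R d -> torus R d, toral_endomorphism M T.
Proof.
have /choice[r rK] := @torus_proj_surj R d.
exists (fun t => torus_proj (map_mx intr M *m r t)) => x.
apply/torus_projP; rewrite -mulmxBr.
by have /torus_projP[p ->] := rK (torus_proj x); exists (M *m p); rewrite map_mxM.
Qed.

Definition hyperbolic_mx (R : realType) (d : nat) (M : 'M[int]_d) : Prop :=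
  forall z : R[i], eigenvalue (map_mx intr M : 'M[R[i]]_d) z -> `|z| != 1.

(* M may be singular, so T need not be surjective. *)
Definition hyperbolic_toral_endomorphism (R : realType) (d : nat)
  (T : torus R d -> torus R d) : Prop :=
  exists2 M : 'M[int]_d, toral_endomorphism M T & hyperbolic_mx R M.

Definition borel (X : ptopologicalType) := g_sigma_algebraType (@open X).

(* The coarsest topology making mu |-> \int f dmu continuous for every
   continuous f : X -> R; it is used below only for X compact.
   A term of type `probability` is a function on all subsets of X, constrained
   only on Borel sets. Two terms that agree on Borel sets represent the same
   measure and are topologically indistinguishable here, so every open set is a
   union of classes of such terms; identifying them changes neither density,
   nor nowhere density, nor meagerness of sets defined by Borel values. *)
Definition weak_star (R : realType) (X : ptopologicalType) : topologicalType :=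
  initial_topology
    (fun (mu : probability (borel X) R) =>
       (fun f : continuousType X R => Rintegral mu setT f) :
         {ptws continuousType X R -> R}).

(* As a type, this set carries the library's subspace topology. *)
Definition invariant_probability (R : realType) (X : ptopologicalType)
    (T : X -> X) : set (weak_star R X) :=
  [set mu : probability (borel X) R |
    forall A : set (borel X), measurable A -> mu (T @^-1` A) = mu A].
Arguments invariant_probability R {X} T.

Definition nowhere_dense (X : topologicalType) (A : set X) : Prop :=
  interior (closure A) = set0.

Definition meager (X : topologicalType) (A : set X) : Prop :=
  exists2 F : (set X)^nat, forall n, nowhere_dense (F n) & A `<=` \bigcup_n F n.

Definition comeager (X : topologicalType) (A : set X) : Prop := meager (~` A).

(* `|_| on 'cV[R]_d is the sup norm; all norms on R^d yield the same set, since
   a constant factor is absorbed by increasing n. *)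
Definition liouville_points (R : realType) (d : nat) : set (torus R d) :=
  [set torus_proj x | x in
    [set x : 'cV[R]_d | forall n : nat, exists (p : 'cV[int]_d) (q : nat),
      [/\ (0 < q)%N, (n <= q)%N &
          `|x - q%:R^-1 *: map_mx intr p| < (q%:R ^+ n)^-1 ]]].

(* Main.v *)
Require Import Defs.
From HB Require Import structures.
From mathcomp Require Import all_boot all_order all_algebra.
From mathcomp Require Import all_classical all_reals all_analysis.
From mathcomp Require Import complex measurable_realfun ring.

Set Implicit Arguments.
Unset Strict Implicit.
Unset Printing Implicit Defensive.

Import Order.TTheory GRing.Theory Num.Theory.
Import numFieldNormedType.Exports.

Local Open Scope classical_set_scope.
Local Open Scope ring_scope.

(** The set of Liouville points is the intersection of the open sets
    [U_n = liouville_level n] of points within [q^-n] of a fraction of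
    denominator [q >= n].  A measure gives it full measure as soon as
    [mu (U_n) > 1 - 1/(n+1)] for every [n], because the [U_n] decrease.  A
    rational point lies in every [U_n], so an invariant measure carried by
    finitely many rational points has a whole weak-* neighbourhood on which
    [mu (U_n) > 1 - 1/(n+1)]: test it against a continuous function that is at
    most the indicator of [U_n] and equals 1 on all fractions of one common
    denominator ([liouville_level_bump]).  It remains to see that such measures
    are dense; then the complements of these neighbourhoods are nowhere dense
    and cover the exceptional measures.

    For density, let [A] be the matrix of [T], acting on R^d, and let [N > 0].
    Given [x], round [(A^N - 1) x] down to an integer vector [p] and put
    [y = (A^N - 1)^-1 p] ([shadow]).  Then [y] is rational, its class is fixed by
    [T^N], and the orbit of [y] follows that of [x]: the sequence
    [u_k = A^k (x - y)], closed up periodically, satisfies [A u_k = u_(k+1)]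
    except for one bounded jump, and for such cyclic sequences the sum of the
    [|u_k|] is bounded independently of [N] ([cyclic_stability],
    [hyperbolic_sum_le]).  This last bound is where hyperbolicity enters.  On
    N-periodic sequences the shift [S] is an isometry, so [S - l] is bounded
    below by [| |l| - 1 |]; hence so is [chi(S)], the product of the [S - l] over
    the eigenvalues [l], [chi] being the characteristic polynomial.  But
    [chi(A) = 0] by Cayley-Hamilton, and [chi(A) u - chi(S) u] is controlled by
    the jump [A u - S u].  Contracted, annihilated and expanded directions are
    thus treated at once.

    Consequently the time averages over [N] steps of a continuous function along
    the orbits of [x] and [y] differ by an amount that tends to 0 uniformly in
    [x].  Transporting an invariant [mu] by [x |-> y] and averaging along the
    orbit thus gives an invariant measure carried by finitely many rational
    points ([periodic_average]), and these measures converge to [mu] as [N]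
    grows ([periodic_average_cvg]). *)

(** * Cyclic sequences almost solving u_(k+1) = M u_k *)

Section CyclicSequences.
Variables (K : numFieldType) (d : nat).
Implicit Types (u v : nat -> 'cV[K]_d) (M : 'M[K]_d) (x y : 'cV[K]_d).

Definition norm1 x : K := \sum_i `|x i 0|.

Lemma norm1_ge0 x : 0 <= norm1 x.
Proof. exact: sumr_ge0. Qed.

Lemma norm1D x y : norm1 (x + y) <= norm1 x + norm1 y.
Proof. by rewrite -big_split; apply: ler_sum => i _; rewrite mxE ler_normD. Qed.

Lemma norm1Z a x : norm1 (a *: x) = `|a| * norm1 x.
Proof. by rewrite mulr_sumr; apply: eq_bigr => i _; rewrite mxE normrM. Qed.

Lemma norm1N x : norm1 (- x) = norm1 x.
Proof. by rewrite -scaleN1r norm1Z normrN1 mul1r. Qed.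

Lemma norm1M M x : norm1 (M *m x) <= (\sum_i \sum_j `|M i j|) * norm1 x.
Proof.
rewrite mulr_suml; apply: ler_sum => i _.
rewrite mxE (le_trans (ler_norm_sum _ _ _))// mulr_suml; apply: ler_sum => j _.
rewrite normrM ler_wpM2l// /norm1 (bigD1 j)//= lerDl; exact: sumr_ge0.
Qed.

Definition cycle_norm N u : K := \sum_(0 <= k < N) norm1 (u k).

Lemma cycle_norm_ge0 N u : 0 <= cycle_norm N u.
Proof. by apply: sumr_ge0 => i _; exact: norm1_ge0. Qed.

Lemma cycle_normD N u v :
  cycle_norm N (fun k => u k + v k) <= cycle_norm N u + cycle_norm N v.
Proof. by rewrite -big_split; apply: ler_sum => i _; exact: norm1D. Qed.

Lemma cycle_normN N u : cycle_norm N (fun k => - u k) = cycle_norm N u.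
Proof. by apply: eq_bigr => i _; exact: norm1N. Qed.

Lemma cycle_normZ N a u :
  cycle_norm N (fun k => a *: u k) = `|a| * cycle_norm N u.
Proof. by rewrite mulr_sumr; apply: eq_bigr => i _; exact: norm1Z. Qed.

Lemma cycle_normM N M u :
  cycle_norm N (fun k => M *m u k) <= (\sum_i \sum_j `|M i j|) * cycle_norm N u.
Proof. by rewrite mulr_sumr; apply: ler_sum => i _; exact: norm1M. Qed.

Definition periodic N u := forall k, u (k + N)%N = u k.

Lemma cycle_norm_shift N u : periodic N u ->
  cycle_norm N (fun k => u k.+1) = cycle_norm N u.
Proof.
move=> uN; apply: (addrI (norm1 (u 0%N))).
transitivity (\sum_(0 <= k < N.+1) norm1 (u k)); first by rewrite big_nat_recl.
by rewrite big_nat_recr//= addrC -[X in u X]add0n uN.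
Qed.

Definition shift_sub a u : nat -> 'cV[K]_d := fun k => u k.+1 - a *: u k.

Lemma shift_sub_periodic N a u : periodic N u -> periodic N (shift_sub a u).
Proof. by move=> uN k; rewrite /shift_sub -addSn !uN. Qed.

(** The shift preserves the norm of a periodic sequence, so that subtracting [a]
    times the identity moves every sequence by at least [| |a| - 1 |] times its
    norm; this is useful exactly when [a] is off the unit circle. *)
Lemma shift_sub_ge N a u : periodic N u ->
  `| `|a| - 1 | * cycle_norm N u <= cycle_norm N (shift_sub a u).
Proof.
move=> uN; have S0 := cycle_norm_ge0 N u.
rewrite -[X in _ * X]ger0_norm// -normrM real_ler_norml; last first.
  by rewrite realM ?realB ?ger0_real.
apply/andP; split.
- rewrite lerNl -mulNr opprB mulrBl mul1r lerBlDr -{1}(cycle_norm_shift uN).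
  rewrite -cycle_normZ (le_trans _ (cycle_normD _ _ _))// le_eqVlt; apply/orP; left.
  by apply/eqP; apply: eq_bigr => k _; rewrite subrK.
- rewrite mulrBl mul1r lerBlDr -{2}(cycle_norm_shift uN) -cycle_normZ.
  rewrite -[X in _ <= X + _]cycle_normN.
  rewrite (le_trans _ (cycle_normD _ _ _))// le_eqVlt; apply/orP; left.
  by apply/eqP; apply: eq_bigr => k _; rewrite opprB subrK.
Qed.

Lemma shift_sub_le N a u : periodic N u ->
  cycle_norm N (shift_sub a u) <= (1 + `|a|) * cycle_norm N u.
Proof.
move=> uN; rewrite (le_trans (cycle_normD _ _ _))// cycle_normN cycle_normZ.
by rewrite (cycle_norm_shift uN) mulrDl mul1r.
Qed.

Definition shift_prod rs u := foldr shift_sub u rs.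

Lemma shift_prod_periodic N rs u : periodic N u -> periodic N (shift_prod rs u).
Proof. by move=> uN; elim: rs => //= a rs; exact: shift_sub_periodic. Qed.

Lemma shift_prod_ge N rs u : periodic N u ->
  (\prod_(a <- rs) `| `|a| - 1 |) * cycle_norm N u <=
  cycle_norm N (shift_prod rs u).
Proof.
move=> uN; elim: rs => [|a rs IH]; first by rewrite big_nil mul1r.
rewrite big_cons -mulrA (le_trans (ler_wpM2l _ IH))//=.
exact/shift_sub_ge/shift_prod_periodic.
Qed.

Lemma shift_prod_le N rs u : periodic N u ->
  cycle_norm N (shift_prod rs u) <= (\prod_(a <- rs) (1 + `|a|)) * cycle_norm N u.
Proof.
move=> uN; elim: rs => [|a rs IH]; first by rewrite big_nil mul1r.
rewrite big_cons -mulrA (le_trans (shift_sub_le _ (shift_prod_periodic _ uN)))//.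
by rewrite ler_wpM2l ?addr_ge0.
Qed.

(** How far [u] is from an orbit of [M]. *)
Definition defect M u : nat -> 'cV[K]_d := fun k => M *m u k - u k.+1.

Lemma defect_periodic N M u : periodic N u -> periodic N (defect M u).
Proof. by move=> uN k; rewrite /defect -addSn !uN. Qed.

(** [M] acts on the values and the shift on the indices, so they commute. *)
Lemma defect_shift_prod M rs u :
  defect M (shift_prod rs u) = shift_prod rs (defect M u).
Proof.
elim: rs => //= a rs <-; apply/funext => k; rewrite /defect /shift_sub.
rewrite mulmxBr -scalemxAr; move: (M *m _) (M *m _) => y z.
by apply/matrixP => i j; rewrite !mxE; ring.
Qed.

Definition mx_prod M rs x := foldr (fun a y => M *m y - a *: y) x rs.

(** Evaluating the polynomial with roots [rs] at [M] and at the shift gives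
    nearly the same result when [M u] is nearly the shift of [u].  With
    [S] the shift, [q] the polynomial of the remaining roots and [a] the new one,
    [(M - a) q(M) u - (S - a) q(S) u
       = (M - a) (q(M) u - q(S) u) + q(S) (M u - S u)],
    so the constant grows by a factor that ignores the period [N]. *)
Lemma mx_prod_defect M rs : exists2 C, 0 <= C & forall N u, periodic N u ->
  cycle_norm N (fun k => mx_prod M rs (u k) - shift_prod rs u k) <=
  C * cycle_norm N (defect M u).
Proof.
elim: rs => [|a rs [C C0 IH]].
  exists 0 => // N u uN; rewrite mul0r /cycle_norm big1// => k _ /=.
  by rewrite subrr /norm1 big1// => i _; rewrite mxE normr0.
set c := \sum_i \sum_j `|M i j|; set p := \prod_(b <- rs) (1 + `|b|).
have c0 : 0 <= c by apply: sumr_ge0 => i _; exact: sumr_ge0.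
have p0 : 0 <= p by apply: prodr_ge0 => b _; rewrite addr_ge0.
exists ((c + `|a|) * C + p) => [|N u uN].
  by rewrite addr_ge0// mulr_ge0// addr_ge0.
set A := fun k => mx_prod M rs (u k) - shift_prod rs u k.
have -> : (fun k => mx_prod M (a :: rs) (u k) - shift_prod (a :: rs) u k) =
    (fun k => M *m A k + - (a *: A k) + shift_prod rs (defect M u) k).
  apply/funext => k; rewrite -defect_shift_prod /A /defect /= /shift_sub.
  move: (mx_prod _ _ _) (shift_prod rs u k) (shift_prod rs u k.+1) => x y z.
  rewrite mulmxBr scalerBr; move: (M *m x) (M *m y) (a *: x) (a *: y) => *.
  by apply/matrixP => i j; rewrite !mxE; ring.
rewrite (le_trans (cycle_normD _ _ _))// mulrDl lerD ?shift_prod_le//; last exact: defect_periodic.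
rewrite (le_trans (cycle_normD _ _ _))// cycle_normN cycle_normZ.
rewrite (le_trans (lerD (cycle_normM _ _ _) (lexx _)))// -mulrDl -mulrA.
by rewrite ler_wpM2l ?IH ?addr_ge0.
Qed.

End CyclicSequences.

Lemma mx_prodE (K : numFieldType) d (M : 'M[K]_d.+1) rs x :
  mx_prod M rs x = horner_mx M (\prod_(a <- rs) ('X - a%:P)) *m x.
Proof.
elim: rs => [|a rs IH] /=; first by rewrite big_nil rmorph1 mul1mx.
rewrite big_cons rmorphM rmorphB/= horner_mx_X horner_mx_C -mulmxA -IH.
by rewrite mulmxBl mul_scalar_mx.
Qed.

(** The product of the [S - a] over the eigenvalues [a] is bounded below by
    [shift_prod_ge], while the same product for [M] vanishes by Cayley-Hamilton;
    [mx_prod_defect] compares the two.  The point is that [C] does not depend on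
    the period. *)
Lemma cyclic_stability (K : numClosedFieldType) d (M : 'M[K]_d) :
  (forall a, eigenvalue M a -> `|a| != 1) ->
  exists2 C, 0 <= C & forall N u, periodic N u ->
    cycle_norm N u <= C * cycle_norm N (defect M u).
Proof.
case: d M => [|d] M hM.
  by exists 0 => // N u _; rewrite mul0r /cycle_norm big1// => k _; rewrite /norm1 big_ord0.
have [rs] := closed_field_poly_normal (char_poly M).
rewrite (monicP (char_poly_monic M)) scale1r => Mrs.
have [C C0 hC] := mx_prod_defect M rs.
set p := \prod_(a <- rs) `| `|a| - 1 |.
have p0 : 0 < p.
  rewrite /p big_seq; apply: prodr_gt0 => a ars; rewrite normr_gt0 subr_eq0.
  by apply: hM; rewrite eigenvalue_root_char Mrs root_prod_XsubC.
exists (p^-1 * C) => [|N u uN]; first by rewrite mulr_ge0// invr_ge0 ltW.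
rewrite -mulrA mulrC ler_pdivlMr// mulrC (le_trans (shift_prod_ge _ uN))//.
rewrite (le_trans _ (hC N u uN))// -cycle_normN le_eqVlt; apply/orP; left.
apply/eqP; apply: eq_bigr => k _; congr norm1.
by rewrite mx_prodE -Mrs Cayley_Hamilton mul0mx sub0r.
Qed.

(** * Orbits of a hyperbolic real matrix *)

Section RealExpansion.
Variable (R : realType).

Lemma mx_norm_le_norm1 d (x : 'cV[R]_d) : `|x| <= norm1 x.
Proof.
rewrite /Num.norm/= mx_normrE; apply/bigmax_leP; split=> [|[i j] _ /=].
  exact: norm1_ge0.
by rewrite ord1 /norm1 (bigD1 i)//= lerDl; exact: sumr_ge0.
Qed.

Lemma coord_le_norm d (x : 'cV[R]_d) i : `|x i 0| <= `|x|.
Proof.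
rewrite [leRHS]/Num.norm/= mx_normrE.
by apply/bigmax_geP; right; exists (i, 0).
Qed.

Lemma norm1_le_mx_norm d (x : 'cV[R]_d) : norm1 x <= d%:R * `|x|.
Proof.
rewrite (le_trans (ler_sum _ (fun i _ => coord_le_norm x i)))//.
by rewrite sumr_const card_ord mulr_natl.
Qed.

Lemma norm1_complex d (x : 'cV[R]_d) :
  norm1 (map_mx (real_complex R) x) = (norm1 x)%:C%C.
Proof.
rewrite /norm1 rmorph_sum; apply: eq_bigr => i _; rewrite mxE.
by rewrite normc_def/= expr0n/= addr0 sqrtr_sqr.
Qed.

(** Apply [cyclic_stability] to the segment [z, A z, ..., A^(N-1) z] repeated
    with period [N]: it is an orbit of [A] except where it closes up, and there
    its defect is [A^N z - z]. *)
Lemma hyperbolic_sum_le d (A : 'M[R]_d) :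
  (forall z : R[i], eigenvalue (map_mx (real_complex R) A) z -> `|z| != 1) ->
  exists2 C, 0 <= C & forall N (z : 'cV[R]_d), (0 < N)%N ->
    \sum_(0 <= k < N) `|A ^+ k *m z| <= C * `|(A ^+ N - 1%:M) *m z|.
Proof.
move=> /cyclic_stability[C C0 hC].
have CE : C = (complex.Re C)%:C%C.
  by case: C C0 {hC} => a b; rewrite lecE/= => /andP[/eqP -> _].
have C0' : 0 <= complex.Re C by move: C0; rewrite CE lecR.
exists (complex.Re C * d%:R) => [|[//|N] z _]; first by rewrite mulr_ge0.
pose x k := A ^+ (k %% N.+1) *m z.
pose u k := map_mx (real_complex R) (x k).
have uN : periodic N.+1 u by move=> k; rewrite /u /x modnDr.
have := hC _ _ uN.
have -> : cycle_norm N.+1 u = (\sum_(0 <= k < N.+1) norm1 (A ^+ k *m z))%:C%C.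
  rewrite /cycle_norm rmorph_sum big_nat [RHS]big_nat; apply: eq_bigr => k kN.
  by rewrite norm1_complex /x modn_small.
have -> : cycle_norm N.+1 (defect (map_mx (real_complex R) A) u) =
    (norm1 ((A ^+ N.+1 - 1%:M) *m z))%:C%C.
  rewrite /cycle_norm big_nat_recr//= big_nat big1 ?add0r => [|k kN].
    rewrite /defect /u -map_mxM -raddfB norm1_complex /x modnn modn_small//.
    by rewrite expr0 mul1mx mulmxA -[A *m _]exprS mulmxBl mul1mx.
  rewrite /defect /u -map_mxM -raddfB norm1_complex /x !modn_small//; last first.
    by rewrite ltnS ltnW.
  rewrite mulmxA -[A *m _]exprS subrr /norm1 big1// => i _.
  by rewrite mxE normr0.
rewrite CE -rmorphM lecR => h.
rewrite (le_trans (ler_sum _ (fun k _ => mx_norm_le_norm1 _)))//.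
rewrite (le_trans h)// -mulrA ler_wpM2l//; exact: norm1_le_mx_norm.
Qed.

(** A fixed vector [z] of [A^N] makes the right-hand side of
    [hyperbolic_sum_le] vanish, and [`|z|] is one of the terms on the left. *)
Lemma hyperbolic_unit d (A : 'M[R]_d) :
  (forall z : R[i], eigenvalue (map_mx (real_complex R) A) z -> `|z| != 1) ->
  forall N, (0 < N)%N -> A ^+ N - 1%:M \in unitmx.
Proof.
move=> /hyperbolic_sum_le[C C0 hC] N N0.
rewrite unitmxE unitfE -det_tr; apply/negP => /det0P[v v0 vA].
have := hC N v^T N0.
rewrite (_ : (A ^+ N - 1%:M) *m v^T = 0); last first.
  by apply: trmx_inj; rewrite trmx_mul trmxK vA trmx0.
rewrite normr0 mulr0; apply/negP; rewrite -ltNge.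
case: N N0 {vA} => // N _; rewrite big_nat_recl//= expr0 mul1mx ltr_wpDr//.
  exact: sumr_ge0.
by rewrite normr_gt0; apply: contra v0 => /eqP/(congr1 trmx); rewrite trmxK trmx0 => ->.
Qed.

End RealExpansion.

(** * Borel functions and averages of image measures *)

Section BorelFunctions.
Variables (R : realType) (X : ptopologicalType).

Lemma open_borel (A : set X) : open A -> measurable (A : set (borel X)).
Proof. by move=> oA; exact: sub_sigma_algebra. Qed.

Lemma continuous_borel (f : X -> R) :
  continuous f -> measurable_fun setT (f : borel X -> R).
Proof.
move=> /continuousP cf; apply: (measurability _ (RGenOpens.measurableE R)).
move=> _ [_ [a [b ->] <-]]; rewrite setTI.
by apply: open_borel; apply: cf; exact: interval_open.
Qed.

Lemma continuous_borel_map (f : X -> X) :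
  continuous f -> measurable_fun setT (f : borel X -> borel X).
Proof.
move=> /continuousP cf; apply: (@measurability _ _ (borel X) (borel X) setT f (@open X)) => //.
by move=> _ [A oA <-]; rewrite setTI; apply: open_borel; exact: cf.
Qed.

End BorelFunctions.

Lemma countable_preimage_measurable d (X : measurableType d) (I : countType)
    (c : X -> I) : (forall i, measurable (c @^-1` [set i])) ->
  forall E : set I, measurable (c @^-1` E).
Proof.
move=> mc E; rewrite (_ : c @^-1` E = \bigcup_(i : I) c @^-1` ([set i] `&` E)).
  apply: countable_bigcupT_measurable => [|i]; first exact: countableP.
  rewrite preimage_setI; have [Ei|Ei] := pselect (E i).
    rewrite (_ : _ `&` _ = c @^-1` [set i])//.
    by apply/seteqP; split=> [x []//|x /= ->].
  rewrite (_ : _ `&` _ = set0)//.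
  by apply/seteqP; split=> // x [/= ->].
by apply/seteqP; split=> [x Ex|x [i _ [_]]//]; exists (c x).
Qed.

Lemma bounded_integrable d (T : measurableType d) (R : realType)
    (mu : probability T R) (f : T -> R) B :
  measurable_fun setT f -> (forall x, `|f x| <= B) ->
  mu.-integrable setT (EFin \o f).
Proof.
move=> mf fB; apply: measurable_bounded_integrable => //.
  by rewrite ltey_eq fin_num_measure.
by exists B; split=> [|M BM x _ /=]; [exact: num_real|exact/(le_trans (fB x))/ltW].
Qed.

Lemma Rintegral_probability_cst d (T : measurableType d) (R : realType)
  (P : probability T R) (c : R) : Rintegral P setT (cst c) = c.
Proof.
rewrite Rintegral_cst// -[RHS]mulr1; congr (_ * _).
exact: (congr1 fine (probability_setT P)).
Qed.

Section Average.
Context d (T : measurableType d) (R : realType).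
Variables (mu : probability T R).
Variables (phi : {mfun T >-> T}^nat) (n : nat).

Definition average : set T -> \bar R :=
  mscale (n.+1%:R^-1)%:nng (msum (fun k => distribution mu (phi k)) n.+1).

HB.instance Definition _ := Measure.on average.

Lemma average_setT : average setT = 1%:E.
Proof.
rewrite /average /mscale /msum [X in (_ * X)%E](_ : _ = n.+1%:R%:E).
  by rewrite -EFinM/= mulVf.
rewrite [LHS](eq_bigr (fun=> 1%:E)) => [|k _]; last exact: probability_setT.
by rewrite sumEFin sumr_const card_ord.
Qed.

HB.instance Definition _ := Measure_isProbability.Build _ _ _ average average_setT.

Lemma Rintegral_average (f : T -> R) B :
  measurable_fun setT f -> (forall x, `|f x| <= B) ->
  Rintegral average setT f =
  n.+1%:R^-1 * \sum_(k < n.+1) Rintegral mu setT (f \o phi k).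
Proof.
(* Sums and multiples of measures integrate nonnegative functions additively;
   adding the constant [B] reduces a bounded [f] to that case. *)
move=> mf fB; pose g x := f x + B.
have g0 x : 0 <= g x by rewrite -lerBlDr sub0r; have /ler_normlP[] := fB x; rewrite lerNl.
have mg : measurable_fun setT g by exact: measurable_funD.
have gB x : `|g x| <= B + B by rewrite (le_trans (ler_normD _ _))// lerD// ger0_norm// (le_trans _ (fB x)).
have shift (P : probability T R) (h : T -> R) :
    measurable_fun setT h -> (forall x, `|h x| <= B) ->
    Rintegral P setT h = Rintegral P setT (fun x => h x + B) - B.
  move=> mh hB; rewrite RintegralD//; last 2 first.
  - exact: (bounded_integrable _ mh hB).
  - apply: (@bounded_integrable _ _ _ _ _ `|B|); [exact: measurable_cst|by []].
  by rewrite (Rintegral_probability_cst P) addrK.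
have mfphi k : measurable_fun setT (f \o phi k) by exact: measurableT_comp.
have mgphi k : measurable_fun setT (g \o phi k) by exact: measurableT_comp.
rewrite (shift _ f mf fB) (eq_bigr (fun k : 'I__ => Rintegral mu setT (g \o phi k) - B)).
  rewrite big_split/= mulrDr sumrN sumr_const card_ord -[B *+ _]mulr_natl mulrN mulKf//.
  congr (_ - _); rewrite /Rintegral.
  rewrite ge0_integral_mscale//; last 2 first.
  - exact/measurable_EFinP.
  - by move=> x _; rewrite lee_fin g0.
  rewrite ge0_integral_measure_sum//; last 2 first.
  - by move=> x _; rewrite lee_fin g0.
  - exact/measurable_EFinP.
  rewrite (eq_bigr (fun k : 'I_n.+1 => \int[mu]_x ((EFin \o g) \o phi k) x))%E; last first.
    move=> k _; apply: ge0_integral_distribution; first exact/measurable_EFinP.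
    by move=> x; rewrite lee_fin g0.
  have fin (k : 'I_n.+1) : (\int[mu]_x ((EFin \o g) \o phi k) x)%E \is a fin_num.
    apply: integrable_fin_num => //.
    by apply: (bounded_integrable mu (B := B + B) (mgphi k)) => x; exact: gB.
  rewrite fineM//; first by rewrite -sum_fine.
  by apply/sum_fin_numP => k _ _; exact: fin.
by move=> k _; apply: (shift mu _ (mfphi k)) => x; exact: fB.
Qed.

End Average.

Section BoundedIntegrals.
Context d (T : measurableType d) (R : realType) (mu : probability T R).

Lemma Rintegral_invariant (g : T -> T) (f : T -> R) B :
  measurable_fun setT g ->
  (forall A, measurable A -> mu (g @^-1` A) = mu A) ->
  measurable_fun setT f -> (forall x, `|f x| <= B) ->
  Rintegral mu setT (f \o g) = Rintegral mu setT f.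
Proof.
move=> mg gmu mf fB; congr fine.
pose gm : {mfun T >-> T} := HB.pack g (isMeasurableFun.Build _ _ _ _ g mg).
rewrite [RHS](eq_measure_integral (distribution mu gm)); last first.
  by move=> A mA _; exact/esym/gmu.
rewrite [RHS](integral_distribution (X := gm) (f := EFin \o f))//.
  exact/measurable_EFinP.
apply: (bounded_integrable mu (B := B)); first exact: measurableT_comp.
by move=> x; exact: fB.
Qed.

Lemma Rintegral_sum_le (g : nat -> T -> R) B C n :
  (forall k, measurable_fun setT (g k)) -> (forall k x, `|g k x| <= B) ->
  (forall x, \sum_(k < n) `|g k x| <= C) ->
  \sum_(k < n) `|Rintegral mu setT (g k)| <= C.
Proof.
move=> mg gB gC.
have mg' k : measurable_fun setT (fun x => `|g k x|) by exact: measurableT_comp.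
have ig k : mu.-integrable setT (EFin \o g k) by exact: (bounded_integrable mu (mg k) (gB k)).
have ig' k : mu.-integrable setT (EFin \o (fun x => `|g k x|)).
  by apply: (bounded_integrable mu (mg' k)) => x; rewrite normr_id; exact: gB.
apply: (@le_trans _ _ (\sum_(k < n) Rintegral mu setT (fun x => `|g k x|))).
  by apply: ler_sum => k _; exact: le_normr_Rintegral.
have -> : \sum_(k < n) Rintegral mu setT (fun x => `|g k x|) =
    Rintegral mu setT (fun x => \sum_(k < n) `|g k x|).
  rewrite /Rintegral sum_fine; last by move=> k _; exact: (integrable_fin_num _ (ig' k)).
  rewrite -(integral_sum measurableT (fun k : 'I_n => ig' k)); congr fine; apply: eq_integral => x _.
  by rewrite -sumEFin.
rewrite -[leRHS](Rintegral_probability_cst mu); apply: le_Rintegral => //.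
  rewrite (_ : EFin \o _ = (fun x => \sum_(k < n) (`|g k x|)%:E)%E).
    by apply: integrable_sum => // k _; exact: ig'.
  by apply/funext => x; rewrite /= -sumEFin.
by apply: (bounded_integrable mu (B := `|C|)) => //; exact: measurable_cst.
Qed.
End BoundedIntegrals.

(** * Continuous functions on the torus *)

Section TorusFunctions.
Variables (R : realType).

Lemma lipschitz_continuous (V W : normedModType R) (f : V -> W) K :
  (forall x y, `|f x - f y| <= K * `|x - y|) -> continuous f.
Proof.
move=> fK x; apply/cvgrPdist_lt => e e0.
have K0 : 0 < `|K| + 1 by rewrite ltr_wpDl.
have r0 : 0 < e / (`|K| + 1) by rewrite divr_gt0.
apply/nbhs_ballP; exists (e / (`|K| + 1)) => //= y; rewrite -ball_normE/= => xy.
rewrite (le_lt_trans (fK x y))// (le_lt_trans (ler_wpM2r _ (ler_norm K)))//.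
rewrite ltr_pdivlMr// mulrC in xy.
by rewrite (le_lt_trans _ xy)// ler_wpM2r// lerDl.
Qed.

Lemma mulmx_bound d (A : 'M[R]_d) :
  exists K, forall x : 'cV[R]_d, `|A *m x| <= K * `|x|.
Proof.
exists ((\sum_i \sum_j `|A i j|) * d%:R) => x.
rewrite (le_trans (mx_norm_le_norm1 _))// (le_trans (norm1M _ _))// -mulrA.
rewrite ler_wpM2l ?norm1_le_mx_norm//.
by apply: sumr_ge0 => i _; exact: sumr_ge0.
Qed.

Lemma mulmx_continuous d (A : 'M[R]_d) : continuous (fun x : 'cV[R]_d => A *m x).
Proof.
have [K AK] := mulmx_bound A.
by apply: (@lipschitz_continuous _ _ _ K) => x y; rewrite -mulmxBr.
Qed.

Lemma trmx_continuous d : continuous (fun x : 'rV[R]_d => x^T).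
Proof.
apply: (@lipschitz_continuous _ _ _ 1) => x y; rewrite mul1r -raddfB/=.
rewrite [leLHS]/Num.norm/= mx_normrE; apply/bigmax_leP; split=> // -[i j] _ /=.
rewrite mxE [leRHS]/Num.norm/= mx_normrE.
by apply/bigmax_geP; right; exists (j, i).
Qed.

Definition unit_cube d : set 'cV[R]_d := [set x | forall i, 0 <= x i 0 <= 1].
Arguments unit_cube : clear implicits.

Lemma unit_cube_compact d : compact (unit_cube d).
Proof.
have -> : unit_cube d = (fun x : 'rV[R]_d => x^T) @`
    [set v : 'rV[R]_d | forall i, `[0, 1]%classic (v ord0 i)].
  apply/seteqP; split=> [x x01|_ [v v01 <-] i]; last first.
    by rewrite mxE; have := v01 i; rewrite /= in_itv.
  by exists x^T; rewrite ?trmxK// => i; rewrite /= in_itv/= mxE; exact: x01.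
apply: continuous_compact; first exact/continuous_subspaceT/trmx_continuous.
have := @rV_compact R d (fun=> `[0, 1]%classic).
by apply=> i; exact: segment_compact.
Qed.

Definition vfloor d (x : 'cV[R]_d) : 'cV[int]_d := \col_i Num.floor (x i 0).

Definition vfrac d (x : 'cV[R]_d) : 'cV[R]_d := x - map_mx intr (vfloor x).

Lemma vfrac_itv d (x : 'cV[R]_d) i : 0 <= vfrac x i 0 < 1.
Proof. by rewrite !mxE subr_ge0 floor_le_tmp/= ltrBlDl -intrD1 floorD1_gt. Qed.

Lemma vfrac_unit_cube d (x : 'cV[R]_d) : unit_cube d (vfrac x).
Proof. by move=> i; have /andP[-> /ltW] := vfrac_itv x i. Qed.

Lemma torus_projD d (x : 'cV[R]_d) p : torus_proj (x + map_mx intr p) = torus_proj x.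
Proof. by apply/torus_projP; exists p; rewrite addrAC subrr add0r. Qed.

Lemma torus_projB d (x : 'cV[R]_d) p : torus_proj (x - map_mx intr p) = torus_proj x.
Proof. by rewrite -(torus_projD (x - _) p) subrK. Qed.

Lemma torus_proj_continuous d : continuous (@torus_proj R d).
Proof. exact: pi_continuous. Qed.

Lemma torus_openE d (A : set (torus R d)) : open A = open (@torus_proj R d @^-1` A).
Proof. by []. Qed.

Lemma torus_continuous d (Z : topologicalType) (f : torus R d -> Z) :
  continuous (f \o @torus_proj R d) -> continuous f.
Proof. by move=> /quotient_continuous. Qed.

Lemma toral_endomorphism_continuous d (M : 'M[int]_d) (T : torus R d -> torus R d) :
  toral_endomorphism M T -> continuous T.
Proof.
move=> MT; apply: torus_continuous.
rewrite (_ : T \o _ = @torus_proj R d \o (fun x => map_mx intr M *m x)); last first.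
  by apply/funext => x; exact: MT.
move=> x; apply: continuous_comp; first exact: mulmx_continuous.
exact: torus_proj_continuous.
Qed.

Section ContinuousFunction.
Variables (d : nat) (f : torus R d -> R).
Hypothesis cf : continuous f.
Let g x := f (torus_proj x).

Let cg : continuous g.
Proof. by move=> x; apply: continuous_comp; [exact: torus_proj_continuous|exact: cf]. Qed.

Lemma torus_bounded : exists B, forall t, `|f t| <= B.
Proof.
have /compact_bounded[B [_ fB]] : compact (g @` unit_cube d).
  by apply: continuous_compact; [exact: continuous_subspaceT|exact: unit_cube_compact].
exists (B + 1) => t; have [x <-] := torus_proj_surj t.
rewrite -(torus_projB x (vfloor x)) -/(vfrac x).
apply: (fB (B + 1)); first by rewrite ltrDl.
by exists (vfrac x) => //; exact: vfrac_unit_cube.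
Qed.

(** Compactness of the unit cube gives a radius for base points in the cube, and
    both points can be translated there by one integer vector. *)
Lemma torus_unif_continuous e : 0 < e ->
  exists2 r, 0 < r & forall x y, `|x - y| < r -> `|g x - g y| < e.
Proof.
move=> e0; have e20 : 0 < e / 2 by rewrite divr_gt0.
have /compact_near_coveringP := @unit_cube_compact d.
move=> /(_ _ (0^'+) (fun r x => forall y, `|x - y| < r -> `|g x - g y| < e)) H.
have {}H : \forall r \near 0^'+, unit_cube d `<=`
    (fun x => forall y, `|x - y| < r -> `|g x - g y| < e).
  apply: H => x _; have /cvgrPdist_lt/(_ _ e20) := @cg x.
  move=> /nbhs_ballP[r /= r0 hr]; have r20 : 0 < r / 2 by rewrite divr_gt0.
  exists (ball x (r / 2), [set s | s < r / 2]) => /=.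
    by split; [exact: nbhsx_ballx|exact: nbhs_right_lt].
  move=> [x' s] [/= xx' sr] y x'y.
  have gx' : `|g x - g x'| < e / 2.
    by apply: hr; apply: le_ball xx'; rewrite ler_pdivrMr// ler_pMr// ler1n.
  have gy : `|g x - g y| < e / 2.
    apply: hr; rewrite [r]splitr; apply: ball_triangle xx' _.
    by rewrite -ball_normE/=; exact: lt_trans sr.
  by rewrite distrC in gx'; rewrite [e]splitr (le_lt_trans (ler_distD (g x) _ _))// ltrD.
have [r /= r0 hr] : exists2 r, 0 < r & unit_cube d `<=`
    (fun x => forall y, `|x - y| < r -> `|g x - g y| < e).
  near (at_right (0 : R)) => r; exists r; first by near: r; exact: nbhs_right_gt.
  by near: r; exact: H.
exists r => // x y xy.
rewrite /g -(torus_projB x (vfloor x)) -(torus_projB y (vfloor x)).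
by apply: hr; [exact: vfrac_unit_cube|rewrite opprB addrA subrK].
Unshelve. all: by end_near. Qed.

(** Uniform continuity in a form that can be summed along an orbit: the total
    variation is controlled by the number of terms times [e] plus [K] times the
    sum of the distances. *)
Lemma torus_affine_modulus e : 0 < e ->
  exists2 K, 0 <= K & forall x y, `|g x - g y| <= e + K * `|x - y|.
Proof.
move=> e0; have [B fB] := torus_bounded.
have [r r0 hr] := torus_unif_continuous e0.
have B0 : 0 <= B by exact: le_trans (fB point).
exists ((B + B) / r) => [|x y]; first by rewrite divr_ge0 ?addr_ge0// ltW.
have [xy|xy] := ltP `|x - y| r.
  by rewrite (le_trans (ltW (hr _ _ xy)))// lerDl mulr_ge0// divr_ge0 ?addr_ge0// ltW.
rewrite (le_trans (ler_normB _ _))// (le_trans (lerD (fB _) (fB _)))//.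
rewrite ler_wpDl ?(ltW e0)//.
by rewrite mulrAC -mulrA ler_peMr ?addr_ge0// ler_pdivlMr// mul1r.
Qed.

End ContinuousFunction.
End TorusFunctions.

(** * Shadowing by rational periodic points *)

Lemma hyperbolic_mx_complex (R : realType) d (M : 'M[int]_d) :
  hyperbolic_mx R M -> forall z : R[i],
  eigenvalue (map_mx (real_complex R) (map_mx intr M)) z -> `|z| != 1.
Proof.
move=> hM z; rewrite -map_mx_comp (_ : map_mx _ M = map_mx intr M); first exact: hM.
by apply/matrixP => i j; rewrite !mxE /= rmorph_int.
Qed.

Section Shadowing.
Variables (R : realType) (d : nat).

(** A point whose class is fixed by [A^N], obtained by rounding [(A^N - 1) x] to
    the lattice. *)
Definition shadow (A : 'M[R]_d) N (x : 'cV[R]_d) : 'cV[R]_d :=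
  invmx (A ^+ N - 1%:M) *m map_mx intr (vfloor ((A ^+ N - 1%:M) *m x)).

Lemma norm_vfrac (x : 'cV[R]_d) : `|vfrac x| <= 1.
Proof.
rewrite [leLHS]/Num.norm/= mx_normrE; apply/bigmax_leP; split=> // -[i j] _ /=.
by have /andP[x0 /ltW x1] := vfrac_itv x i; rewrite ord1 ger0_norm.
Qed.

Lemma shadow_sub A N x : A ^+ N - 1%:M \in unitmx ->
  (A ^+ N - 1%:M) *m (x - shadow A N x) = vfrac ((A ^+ N - 1%:M) *m x).
Proof. by move=> AN; rewrite mulmxBr /shadow mulKVmx. Qed.

Lemma shadow_fixed A N x : A ^+ N - 1%:M \in unitmx ->
  torus_proj (A ^+ N *m shadow A N x) = torus_proj (shadow A N x).
Proof.
move=> AN; apply/torus_projP; exists (vfloor ((A ^+ N - 1%:M) *m x)).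
by rewrite -[X in _ - X]mul1mx -mulmxBl /shadow mulKVmx.
Qed.

Lemma shadow_sum A :
  (forall z : R[i], eigenvalue (map_mx (real_complex R) A) z -> `|z| != 1) ->
  exists2 C, 0 <= C & forall N x, (0 < N)%N ->
    \sum_(0 <= k < N) `|A ^+ k *m x - A ^+ k *m shadow A N x| <= C.
Proof.
move=> hA; have [C C0 hC] := hyperbolic_sum_le hA.
exists C => // N x N0; under eq_bigr do rewrite -mulmxBr.
rewrite (le_trans (hC N _ N0))// shadow_sub ?hyperbolic_unit//.
by rewrite -[leRHS]mulr1 ler_wpM2l ?norm_vfrac.
Qed.

Lemma map_intr_mxX (M : 'M[int]_d) k :
  (map_mx intr M : 'M[R]_d) ^+ k = map_mx intr (M ^+ k).
Proof. by elim: k => [|k IH]; rewrite ?map_mx1// !exprS map_mxM IH. Qed.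

(** The denominator is [|det (M^N - 1)|], by Cramer's formula. *)
Lemma shadow_rational (M : 'M[int]_d) N :
  (map_mx intr M : 'M[R]_d) ^+ N - 1%:M \in unitmx ->
  exists2 q : nat, (0 < q)%N & forall k x, exists p : 'cV[int]_d,
    q%:R *: ((map_mx intr M : 'M[R]_d) ^+ k *m shadow (map_mx intr M) N x) = map_mx intr p.
Proof.
set A := map_mx intr M => AN; pose B := M ^+ N - 1%:M.
have AB : A ^+ N - 1%:M = map_mx intr B.
  by rewrite /A /B map_intr_mxX map_mxB map_mx1.
have detB : \det (A ^+ N - 1%:M) = (\det B)%:~R by rewrite AB det_map_mx.
have B0 : \det B != 0.
  by move: AN; rewrite unitmxE unitfE detB intr_eq0.
exists `|\det B|%N; first by rewrite absz_gt0.
move=> k x; rewrite /shadow; set p := vfloor _.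
exists (sgz (\det B) *: (M ^+ k *m (\adj B *m p))).
rewrite /invmx AN detB AB -map_mx_adj map_intr_mxX -!scalemxAl -scalemxAr.
rewrite -!map_mxM map_mxZ/= !scalerA; congr (_ *: _).
by rewrite natr_absz -abszE abszEsg intrM mulfK ?intr_eq0.
Qed.

Lemma toral_endomorphism_iter M T k (x : 'cV[R]_d) : toral_endomorphism M T ->
  iter k T (torus_proj x) = torus_proj (map_mx intr M ^+ k *m x).
Proof.
move=> MT; elim: k => [|k IH]; first by rewrite expr0 mul1mx.
by rewrite iterS IH MT mulmxA exprS.
Qed.

End Shadowing.

(** * A Borel fundamental domain *)

Section TorusLift.
Variables (R : realType) (d : nat).

Definition torus_lift (t : torus R d) : 'cV[R]_d :=
  vfrac (sval (cid (torus_proj_surj t))).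

Lemma torus_liftK t : torus_proj (torus_lift t) = t.
Proof. by rewrite torus_projB; case: cid. Qed.

Lemma vfracD (x : 'cV[R]_d) p : vfrac (x + map_mx intr p) = vfrac x.
Proof.
apply/matrixP => i j; rewrite ord1 !mxE floorDrz ?intr_int//= intrKfloor intrD.
by rewrite opprD addrACA subrr addr0.
Qed.

Lemma torus_lift_proj (x : 'cV[R]_d) : torus_lift (torus_proj x) = vfrac x.
Proof.
rewrite /torus_lift; case: cid => y /= /torus_projP[p yx].
by rewrite -[y](subrK x) yx addrC vfracD.
Qed.

(** The fractional part is lower semicontinuous on the torus: for [b >= 0], it
    exceeds [b] on the union of the open slabs [n + b < x_i < n + 1]. *)
Lemma measurable_torus_lift i :
  measurable_fun setT (fun t : borel (torus R d) => torus_lift t i 0).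
Proof.
apply: (measurability _ (RGenOInfty.measurableE R)) => _ [_ [b ->] <-].
rewrite setTI; apply: open_borel.
have [b0|b0] := ltP b 0.
  rewrite (_ : _ @^-1` _ = setT); first exact: openT.
  apply/seteqP; split=> // t _; rewrite /= in_itv/= andbT.
  by rewrite (lt_le_trans b0)//; have /andP[] := vfrac_itv (sval (cid (torus_proj_surj t))) i.
rewrite torus_openE (_ : _ @^-1` _ = \bigcup_(n : int)
    [set x : 'cV[R]_d | x i 0 \in `]n%:~R + b, n%:~R + 1[]).
  apply: bigcup_open => n _.
  apply: (@open_comp _ _ (fun x : 'cV[R]_d => x i 0) `]n%:~R + b, n%:~R + 1[%classic).
    by move=> x _; exact: coord_continuous.
  exact: interval_open.
apply/seteqP; split=> x /=; rewrite torus_lift_proj in_itv/= andbT.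
  rewrite !mxE => bx; exists (Num.floor (x i 0)) => //=.
  by rewrite in_itv/= -ltrBrDl bx -intrD1 floorD1_gt.
move=> [n _]; rewrite /= in_itv/= => /andP[bx xn].
rewrite !mxE (_ : Num.floor _ = n) ?ltrBrDl//; apply/eqP.
by rewrite floor_eq intrD xn andbT (le_trans _ (ltW bx))// lerDl.
Qed.

Lemma measurable_vfloor_lift (B : 'M[R]_d) (E : set 'cV[int]_d) :
  measurable ((fun t : borel (torus R d) => vfloor (B *m torus_lift t)) @^-1` E).
Proof.
apply: countable_preimage_measurable => p.
pose h i (t : borel (torus R d)) := (B *m torus_lift t) i 0.
have mh i : measurable_fun setT (h i).
  rewrite (_ : h i = (fun t => \sum_j B i j * torus_lift t j 0)); last first.
    by apply/funext => t; rewrite /h mxE.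
  apply: measurable_sum => j; apply: measurable_funM; first exact: measurable_cst.
  exact: measurable_torus_lift.
rewrite (_ : _ @^-1` _ = \bigcap_(i in [set: 'I_d])
    h i @^-1` `[(p i 0)%:~R, (p i 0 + 1)%:~R[%classic).
  apply: fin_bigcap_measurable => //.
  by move=> i _; rewrite -[X in measurable X]setTI; apply: mh.
apply/seteqP; split=> t.
  by move=> /= <- i _; rewrite /= in_itv/= -floor_eq mxE.
move=> tp; apply/matrixP => i j; rewrite ord1 mxE; apply/eqP; rewrite floor_eq.
by have := tp i I; rewrite /= in_itv.
Qed.

End TorusLift.

(** * Periodic approximations of an invariant measure *)

Section PeriodicAverages.
Variables (R : realType) (d : nat) (M : 'M[int]_d) (T : torus R d -> torus R d).
Hypotheses (MT : toral_endomorphism M T) (hM : hyperbolic_mx R M).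
Local Notation A := (map_mx intr M : 'M[R]_d).

Let unitA n : A ^+ n.+1 - 1%:M \in unitmx.
Proof. exact: (hyperbolic_unit (hyperbolic_mx_complex hM)). Qed.

Let T_borel : measurable_fun setT (T : borel (torus R d) -> borel (torus R d)).
Proof. by apply: continuous_borel_map; exact: toral_endomorphism_continuous MT. Qed.

Definition shadow_orbit n k (t : borel (torus R d)) : borel (torus R d) :=
  torus_proj (A ^+ k *m shadow A n.+1 (torus_lift t)).

(** The map factors through [vfloor], which has countably many values, so the
    preimage of any set at all is Borel. *)
Lemma measurable_shadow_orbit n k : measurable_fun setT (shadow_orbit n k).
Proof.
move=> _ E _; rewrite setTI.
exact: (@measurable_vfloor_lift R d (A ^+ n.+1 - 1%:M) [set p | E (torus_proj
  (A ^+ k *m (invmx (A ^+ n.+1 - 1%:M) *m map_mx intr p)))]).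
Qed.

HB.instance Definition _ n k :=
  isMeasurableFun.Build _ _ _ _ (shadow_orbit n k) (measurable_shadow_orbit n k).

Lemma shadow_orbitS n k : T \o shadow_orbit n k = shadow_orbit n k.+1.
Proof. by apply/funext => t; rewrite /= MT mulmxA -[A *m _]exprS. Qed.

Lemma shadow_orbit_cycle n : shadow_orbit n n.+1 = shadow_orbit n 0.
Proof. by apply/funext => t; rewrite /shadow_orbit shadow_fixed// expr0 mul1mx. Qed.

Variable mu : probability (borel (torus R d)) R.

Definition periodic_average n : probability (borel (torus R d)) R :=
  average mu (fun k => shadow_orbit n k : {mfun _ >-> _}) n.

Lemma periodic_averageE n E : periodic_average n E =
  (n.+1%:R^-1%:E * \sum_(k < n.+1) mu (shadow_orbit n k @^-1` E))%E.
Proof. by []. Qed.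

(** [T] permutes the [n.+1] image measures cyclically. *)
Lemma periodic_average_invariant n :
  invariant_probability R T (periodic_average n).
Proof.
move=> E mE; rewrite !periodic_averageE; congr (_ * _)%E.
under eq_bigr => k _ do rewrite -comp_preimage shadow_orbitS.
rewrite big_ord_recr big_ord_recl/= addeC.
by rewrite shadow_orbit_cycle.
Qed.

Hypothesis muT : invariant_probability R T mu.

(** By invariance, [f] may be replaced by its mean along the orbit under [T]; the
    mean along the shadowing orbit differs by at most [e + K * C / n.+1], where
    [C] bounds the sum of the distances between the two orbits. *)
Lemma periodic_average_cvg (f : torus R d -> R) : continuous f ->
  Rintegral (periodic_average n) setT f @[n --> \oo] --> Rintegral mu setT f.
Proof.
move=> cf; have mf := continuous_borel cf.
have [B fB] := torus_bounded cf.
have [C C0 hC] := shadow_sum (hyperbolic_mx_complex hM).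
pose Tk k := iter k T.
have mTk k : measurable_fun setT (Tk k : borel (torus R d) -> borel (torus R d)).
  elim: k => [|k IH]; first exact: measurable_id.
  exact: (measurableT_comp T_borel IH).
have fTk k : Rintegral mu setT (f \o Tk k) = Rintegral mu setT f.
  elim: k => // k <-.
  pose h : borel (torus R d) -> R := f \o Tk k.
  rewrite -[RHS](Rintegral_invariant (f := h) (B := B) T_borel muT).
  - by congr Rintegral; apply/funext => t; exact: (congr1 f (iterSr k T t)).
  - exact: (measurableT_comp mf (mTk k)).
  - by move=> t; exact: fB.
have key e K n : (forall x y, `|f (torus_proj x) - f (torus_proj y)| <= e + K * `|x - y|) ->
    0 <= K ->
    `|Rintegral mu setT f - Rintegral (periodic_average n) setT f| <=
    e + K * C * n.+1%:R^-1.
  move=> fK K0; rewrite (Rintegral_average mu _ n mf fB).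
  pose g k t := f (Tk k t) - f (shadow_orbit n k t).
  have mg k : measurable_fun setT (g k : borel (torus R d) -> R).
    apply: measurable_funB; first exact: (measurableT_comp mf (mTk k)).
    exact: (measurableT_comp mf (measurable_shadow_orbit n k)).
  have gB k x : `|g k x| <= B + B.
    by rewrite (le_trans (ler_normB _ _))// lerD// fB.
  have gC x : \sum_(k < n.+1) `|g k x| <= n.+1%:R * e + K * C.
    rewrite (@le_trans _ _ (\sum_(k < n.+1) (e + K *
      `|A ^+ k *m torus_lift x - A ^+ k *m shadow A n.+1 (torus_lift x)|)))//.
      apply: ler_sum => k _; rewrite /g /Tk -{1}(torus_liftK x).
      by rewrite (toral_endomorphism_iter k _ MT); exact: fK.
    rewrite big_split/= sumr_const card_ord -[e *+ _]mulr_natl lerD2l.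
    rewrite -mulr_sumr ler_wpM2l//.
    by have := hC n.+1 (torus_lift x) isT; rewrite big_mkord.
  have gI k : Rintegral mu setT (g k) =
      Rintegral mu setT f - Rintegral mu setT (f \o shadow_orbit n k).
    rewrite -(fTk k) -RintegralB//.
    - by apply: (bounded_integrable mu (B := B)) (measurableT_comp mf (mTk k)) _ => t; exact: fB.
    - apply: (bounded_integrable mu (B := B)) (measurableT_comp mf (measurable_shadow_orbit n k)) _ => t.
      exact: fB.
  have := Rintegral_sum_le mu mg gB gC.
  under eq_bigr do rewrite gI.
  move=> /(le_trans (ler_norm_sum _ _ _)).
  rewrite sumrB sumr_const card_ord => h.
  rewrite -[Rintegral mu setT f](mulKf (_ : n.+1%:R != 0))// -mulrBr mulr_natl.
  rewrite normrM gtr0_norm ?invr_gt0// mulrC ler_pdivrMr// (le_trans h)//.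
  by rewrite mulrDl mulrVK ?unitfE// [e * _]mulrC.
apply/cvgrPdist_lt => e e0; have e20 : 0 < e / 2 by rewrite divr_gt0.
have [K K0 fK] := torus_affine_modulus cf e20.
have KC0 : 0 < K * C + 1 by rewrite ltr_wpDl// mulr_ge0.
have e'0 : 0 < e / 2 / (K * C + 1) by rewrite divr_gt0.
near=> n; rewrite (le_lt_trans (key _ _ n fK K0))// [ltRHS]splitr ltrD2l.
have h : n.+1%:R^-1 < e / 2 / (K * C + 1).
  by near: n; exact: (near_infty_natSinv_lt (PosNum e'0)).
rewrite ltr_pdivlMr// mulrC in h.
by rewrite (le_lt_trans _ h)// ler_wpM2r// lerDl.
Unshelve. all: by end_near. Qed.

(** All of the mass sits on the shadowing orbits. *)
Lemma Rintegral_periodic_average_eq1 n (f : torus R d -> R) : continuous f ->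
  (forall k t, f (shadow_orbit n k t) = 1) ->
  Rintegral (periodic_average n) setT f = 1.
Proof.
move=> cf f1; have [B fB] := torus_bounded cf.
rewrite (Rintegral_average mu _ n (continuous_borel cf) fB).
rewrite (eq_bigr (fun=> 1)) => [|k _].
  by rewrite sumr_const card_ord mulVf.
rewrite -[RHS](Rintegral_probability_cst mu); apply: eq_Rintegral => t _.
exact: f1.
Qed.

End PeriodicAverages.

(** * Liouville points as an intersection of open sets *)

Section LatticeDistance.
Variables (R : realType) (d : nat).

Let dists (x : 'cV[R]_d) : set R := [set `|x - map_mx intr p| | p in [set: 'cV[int]_d]].

Definition lattice_dist (x : 'cV[R]_d) : R := inf (dists x).

Let dists_neq0 x : dists x !=set0.
Proof. by exists `|x - map_mx intr 0|; exists 0. Qed.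

Let dists_lbound x : has_lbound (dists x).
Proof. by exists 0 => _ [p _ <-]. Qed.

Lemma lattice_dist_le x p : lattice_dist x <= `|x - map_mx intr p|.
Proof. by apply: ge_inf => //; exists p. Qed.

Lemma lattice_dist_ge0 x : 0 <= lattice_dist x.
Proof. by apply: lb_le_inf => // _ [p _ <-]. Qed.

Lemma lattice_dist_lt x r : lattice_dist x < r ->
  exists p : 'cV[int]_d, `|x - map_mx intr p| < r.
Proof. by move=> /inf_lt[//|_ [p _ <-] pr]; exists p. Qed.

Lemma lattice_dist_int p : lattice_dist (map_mx intr p) = 0.
Proof.
by apply/eqP; rewrite eq_le lattice_dist_ge0 (le_trans (lattice_dist_le _ p))// subrr normr0.
Qed.

Let lattice_dist_leD x y : lattice_dist x <= `|x - y| + lattice_dist y.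
Proof.
rewrite -lerBlDl; apply: lb_le_inf => // _ [p _ <-]; rewrite lerBlDl.
by rewrite (le_trans (lattice_dist_le x p))// ler_distD.
Qed.

Lemma lattice_dist_lipschitz x y : `|lattice_dist x - lattice_dist y| <= `|x - y|.
Proof.
rewrite ler_distl lerBlDl; apply/andP; split; last by rewrite addrC.
by rewrite distrC.
Qed.

Lemma lattice_distD x p : lattice_dist (x + map_mx intr p) = lattice_dist x.
Proof.
have h y q : lattice_dist (y + map_mx intr q) <= lattice_dist y.
  apply: lb_le_inf => // _ [r _ <-].
  rewrite (le_trans (lattice_dist_le _ (r + q)))// map_mxD/=.
  by rewrite opprD addrACA subrr addr0.
apply/eqP; rewrite eq_le h/= -{1}[x](addrK (map_mx intr p)) -map_mxN.
exact: h.
Qed.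

End LatticeDistance.

Section Liouville.
Variables (R : realType) (d : nat).

Definition liouville_approx n (x : 'cV[R]_d) : Prop :=
  exists (p : 'cV[int]_d) (q : nat), [/\ (0 < q)%N, (n <= q)%N &
    `|x - q%:R^-1 *: map_mx intr p| < (q%:R ^+ n)^-1 ].

Definition liouville_level n : set (torus R d) :=
  @torus_proj R d @` [set x | liouville_approx n x].

(** Translating by an integer vector keeps the denominator. *)
Lemma liouville_approxD n x m : liouville_approx n x ->
  liouville_approx n (x + map_mx intr m).
Proof.
move=> [p [q [q0 nq xp]]]; exists (p + q%:Z *: m), q; split=> //.
rewrite map_mxD map_mxZ/= scalerDr scalerA mulVf ?pnatr_eq0 -?lt0n// scale1r.
by rewrite opprD addrACA subrr addr0.
Qed.

Lemma liouville_levelE n x : liouville_level n (torus_proj x) <-> liouville_approx n x.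
Proof.
split=> [[y yn /torus_projP[p yx]]|xn]; last by exists x.
by rewrite -[x](subrK y) -opprB yx -map_mxN addrC; exact: liouville_approxD.
Qed.

Lemma liouville_level_open n : open (liouville_level n).
Proof.
rewrite torus_openE (_ : _ @^-1` _ = \bigcup_(q in [set q | (0 < q)%N && (n <= q)%N])
    \bigcup_(p : 'cV[int]_d) ball (q%:R^-1 *: map_mx intr p) (q%:R ^+ n)^-1).
  by apply: bigcup_open => q _; apply: bigcup_open => p _; exact: ball_open.
apply/seteqP; split=> x /=.
  move=> /liouville_levelE[p [q [q0 nq xp]]]; exists q => /=; first by rewrite q0.
  by exists p => //; rewrite -ball_normE/= distrC.
move=> [q /andP[q0 nq] [p _]]; rewrite -ball_normE/= distrC => xp.
by apply/liouville_levelE; exists p, q.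
Qed.

Lemma liouville_level_decreasing m n : (n <= m)%N ->
  liouville_level m `<=` liouville_level n.
Proof.
move=> nm _ [x [p [q [q0 mq xp]]] <-]; exists x => //; exists p, q.
split=> //; first exact: leq_trans mq.
rewrite (lt_le_trans xp)// lef_pV2 ?posrE ?exprn_gt0 ?ltr0n//.
by rewrite ler_weXn2l// ler1n.
Qed.

Lemma liouville_pointsE : @liouville_points R d = \bigcap_n liouville_level n.
Proof.
apply/seteqP; split=> [_ [x xL <-] n _|t tL]; first by exists x => //; exact: xL.
have [x xt] := torus_proj_surj t; exists x => // n.
by apply/liouville_levelE; rewrite xt; exact: tL.
Qed.

(** [f x = 1 - q^n dist(q x, Z^d)].  It is positive only if [q x] is within
    [q^-n] of the lattice, and then [x] is within [q^-(n+1) <= q^-n] of a fraction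
    of denominator [q].  Being negative elsewhere does no harm: only an upper
    bound by the indicator is wanted. *)
Lemma liouville_level_bump n q : (0 < q)%N -> (n <= q)%N ->
  exists f : torus R d -> R, [/\ continuous f, forall t, f t <= \1_(liouville_level n) t &
    forall x p, q%:R *: x = map_mx intr p -> f (torus_proj x) = 1].
Proof.
move=> q0 nq; have q0' : 0 < q%:R :> R by rewrite ltr0n.
have qn0 : 0 < q%:R ^+ n :> R by rewrite exprn_gt0.
pose f (t : torus R d) := 1 - q%:R ^+ n * lattice_dist (q%:R *: torus_lift t).
have fE x : f (torus_proj x) = 1 - q%:R ^+ n * lattice_dist (q%:R *: x).
  rewrite /f torus_lift_proj /vfrac scalerBr.
  rewrite (_ : - (q%:R *: map_mx intr (vfloor x)) = map_mx intr (- (q%:Z *: vfloor x))).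
    by rewrite lattice_distD.
  by rewrite map_mxN map_mxZ.
exists f; split.
- apply: torus_continuous; apply: (@lipschitz_continuous _ _ _ _ (q%:R ^+ n * q%:R)) => x y /=.
  rewrite !fE opprB addrC addrA subrK -mulrBr normrM gtr0_norm// -mulrA ler_wpM2l ?(ltW qn0)//.
  rewrite (le_trans (lattice_dist_lipschitz _ _))// -scalerBr normrZ gtr0_norm//.
  by rewrite distrC.
- move=> t; have [x <-] := torus_proj_surj t; rewrite fE indicE.
  have [xn|xn] := boolP (torus_proj x \in liouville_level n).
    by rewrite gerBl mulr_ge0 ?lattice_dist_ge0// ltW.
  rewrite subr_le0 leNgt; apply: contra xn => xn; rewrite inE; apply/liouville_levelE.
  rewrite mulrC -ltr_pdivlMr// div1r in xn.
  have [p xp] := lattice_dist_lt xn; exists p, q; split=> //.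
  rewrite -[x](scalerK (lt0r_neq0 q0')) -scalerBr normrZ gtr0_norm ?invr_gt0//.
  by rewrite mulrC ltr_pdivrMr// (lt_le_trans xp)// ler_peMr ?ler1n.

- by move=> x p xp; rewrite fE xp lattice_dist_int mulr0 subr0.
Qed.

Lemma Rintegral_le_measure (mu : probability (borel (torus R d)) R)
    (f : torus R d -> R) (A : set (torus R d)) :
  continuous f -> open A -> (forall t, f t <= \1_A t) ->
  ((\int[mu]_t f t)%:E <= mu A)%E.
Proof.
move=> cf oA fA; have mA := open_borel oA; have mf := continuous_borel cf.
have [B fB] := torus_bounded cf.
have mI : measurable_fun setT (\1_A : borel (torus R d) -> R) by exact: measurable_indic.
have -> : mu A = (\int[mu]_t (\1_A t : R))%:E.
  rewrite /Rintegral integral_indic// setIT fineK//; exact: fin_num_measure.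
rewrite lee_fin; apply: le_Rintegral => //.
- exact: (bounded_integrable mu mf fB).
- apply: (bounded_integrable mu (B := 1) mI) => t.
  by rewrite indicE; case: (_ \in _); rewrite ?normr1 ?normr0.
Qed.
End Liouville.

(** * Genericity *)

(** The analogue of [cvg_image] for maps that need not be surjective. *)
Lemma cvg_initial (S : choiceType) (T : topologicalType) (f : S -> T)
    (F : set_system (initial_topology f)) (s : initial_topology f) :
  Filter F -> f @ F --> f s -> F --> s.
Proof.
move=> FF Ff A [_ [[B oB <-] Bs] BA]; apply: filterS BA _.
by apply: Ff; exact: open_nbhs_nbhs.
Qed.

Section WeakStar.
Variables (R : realType) (X : ptopologicalType).

Lemma cvg_weak_star (F : set_system (weak_star R X)) (mu : weak_star R X) :
  Filter F ->
  (forall f : X -> R, continuous f ->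
    Rintegral (nu : probability (borel X) R) setT f @[nu --> F] -->
    Rintegral (mu : probability (borel X) R) setT f) -> F --> mu.
Proof.
move=> FF Ff; apply: cvg_initial; apply/cvg_sup => f; apply: cvg_initial.
exact/Ff/cts_fun.
Qed.

Lemma Rintegral_weak_star_continuous (f : X -> R) : continuous f ->
  continuous (fun mu : weak_star R X =>
    Rintegral (mu : probability (borel X) R) setT f).
Proof.
move=> cf mu; pose g : continuousType X R := mkcts cf.
apply: (@continuous_comp _ _ _ (fun mu : weak_star R X =>
  (fun h : continuousType X R => Rintegral (mu : probability (borel X) R) setT h)
    : {ptws continuousType X R -> R}) (fun h => h g)).
  exact: initial_continuous.
exact: (@proj_continuous _ (fun=> R) g).
Qed.

End WeakStar.

Section Genericity.
Variables (R : realType) (d : nat) (T : torus R d -> torus R d).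
Hypothesis hT : hyperbolic_toral_endomorphism T.

Local Notation P := (invariant_probability R T).
Local Notation prob m := (set_val m : probability (borel (torus R d)) R).

Definition liouville_measures n : set P :=
  [set mu | ((1 - n.+1%:R^-1)%:E < prob mu (@liouville_level R d n))%E].

(** Density of the interior of [liouville_measures n]: the periodic averages of
    [mu] converge to [mu], and each lies in the interior because it gives
    integral 1 to a function that is at most the indicator of the level set. *)
Lemma liouville_measures_dense n (mu : P) :
  closure [set nu : P | nbhs nu (liouville_measures n)] mu.
Proof.
have [M MT hM] := hT.
have muT : invariant_probability R T (prob mu) by exact: set_valP.
pose nu_ k : P := exist _ (periodic_average M (prob mu) k : weak_star R (torus R d))
  (mem_set (periodic_average_invariant MT hM (prob mu) k)).
have nu_cvg : nu_ k @[k --> \oo] --> mu.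
  apply: cvg_initial; apply: cvg_weak_star => f cf.
  exact: (periodic_average_cvg MT hM muT cf).
have nuG k : nbhs (nu_ k) (liouville_measures n).
  have unit : (map_mx intr M : 'M[R]_d) ^+ k.+1 - 1%:M \in unitmx.
    exact: (hyperbolic_unit (hyperbolic_mx_complex hM)).
  have [q q0 qM] := shadow_rational unit.
  have qn0 : (0 < q * n.+1)%N by rewrite muln_gt0 q0.
  have nqn : (n <= q * n.+1)%N by rewrite (leq_trans (leqnSn n))// leq_pmull.
  (* Any multiple of [q] is a common denominator; [n.+1] makes it at least [n]. *)
  have [f [cf fU f1]] := @liouville_level_bump R d n _ qn0 nqn.
  have nuf : Rintegral (prob (nu_ k)) setT f = 1.
    rewrite -[LHS]/(Rintegral (periodic_average M (prob mu) k) setT f).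
    apply: (Rintegral_periodic_average_eq1 _ cf) => j t.
    have [p qp] := qM j (torus_lift t).
    apply: (f1 _ (n.+1%:Z *: p)).
    by rewrite natrM mulrC -scalerA qp map_mxZ.
  pose F (nu : weak_star R (torus R d)) :=
    Rintegral (nu : probability (borel (torus R d)) R) setT f.
  have cF : continuous (F \o (set_val : P -> weak_star R (torus R d))).
    move=> nu; apply: continuous_comp; first exact: initial_continuous.
    exact: Rintegral_weak_star_continuous.
  have : \forall nu \near nu_ k, 1 - n.+1%:R^-1 < (F \o set_val) nu.
    apply: (cvgr_gt _ (cF (nu_ k))).
    by rewrite /= /F nuf gtrBl invr_gt0.
  apply: filterS => nu /= Fnu.
  have {}Fnu : ((1 - n.+1%:R^-1)%:E < (F (set_val nu))%:E)%E by rewrite lte_fin.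
  apply: (lt_le_trans Fnu).
  exact: (Rintegral_le_measure _ cf (@liouville_level_open R d n) fU).
move=> B /nu_cvg[k _ kB].
exists (nu_ k); split; first exact: nuG.
by apply: (kB k) => /=.
Qed.

Lemma liouville_measures_nowhere_dense n : nowhere_dense (~` liouville_measures n).
Proof.
apply/seteqP; split=> // mu muC.
have [nu [nuG nuC]] := @liouville_measures_dense n mu _ muC.
by have [? []] := nuC _ nuG.
Qed.

End Genericity.

Lemma liouville_full (R : realType) d (mu : probability (borel (torus R d)) R) :
  (forall n, ((1 - n.+1%:R^-1)%:E < mu (@liouville_level R d n))%E) ->
  mu (@liouville_points R d) = 1%E.
Proof.
move=> muL; have mL n := open_borel (@liouville_level_open R d n).
have mL1 n : mu (@liouville_level R d n) = 1%E.
  apply/eqP; rewrite eq_le; apply/andP; split; first exact: probability_le1.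
  have Lfin : mu (@liouville_level R d n) \is a fin_num by exact: fin_num_measure.
  rewrite -(fineK Lfin) lee_fin leNgt; apply/negP => L1.
  have e0 : 0 < 1 - fine (mu (@liouville_level R d n)) by rewrite subr_gt0.
  near \oo => m.
  have nm : (n <= m)%N by near: m; exact: nbhs_infty_ge.
  have me : m.+1%:R^-1 < 1 - fine (mu (@liouville_level R d n)).
    by near: m; exact: (near_infty_natSinv_lt (PosNum e0)).
  have : ((1 - m.+1%:R^-1)%:E < mu (@liouville_level R d n))%E.
    rewrite (lt_le_trans (muL m))// le_measure ?inE//.
    exact: liouville_level_decreasing.
  by rewrite -(fineK Lfin) lte_fin ltNge => /negP; apply; rewrite ltW// ltrBrDl -ltrBrDr.
have mLi : measurable (@liouville_points R d : set (borel (torus R d))).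
  by rewrite liouville_pointsE; apply: bigcapT_measurable.
rewrite -[X in mu X]setCK probability_setC; last exact: measurableC.
rewrite (@measure_negligible _ _ _ mu (~` _)) ?sube0//; first exact: measurableC.
rewrite liouville_pointsE setC_bigcap; apply: negligible_bigcup => n.
apply/negligibleP; first exact: measurableC.
by rewrite [LHS](probability_setC _ (mL n)) mL1 subee.
Unshelve. all: by end_near. Qed.

Local Open Scope ereal_scope.

Theorem theorem1p16 (R : realType) (d : nat) (T : torus R d -> torus R d) :
  hyperbolic_toral_endomorphism T ->
  comeager [set mu : invariant_probability R T |
    (set_val mu : probability (borel (torus R d)) R) (@liouville_points R d) = 1].
Proof.
move=> hT; exists (fun n => ~` @liouville_measures R d T n).
  by move=> n; exact: liouville_measures_nowhere_dense.
rewrite -setC_bigcap; apply: subsetC => mu muL.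
by apply: liouville_full => n; exact: muL.
Qed.
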